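(* Suppose $0<q<1$ and let $(r_m/s_m)_{m\in\mathbb N}$ be a convergent sequence of rational numbers. (1) If $r_m/s_m$ converges to an irrational number $t$, then the sequence $([r_m/s_m]^\sharp_q)_m$ converges to a limit which depends only on $t$. (2) If $r_m/s_m$ converges to a rational number $r/s$ from the right, then $[r_m/s_m]^\sharp_q\to[r/s]^\sharp_q$. (3) If $r_m/s_m$ converges to a rational number $r/s$ from the left, then $[r_m/s_m]^\sharp_q\to[r/s]^\flat_q$.
   Context: Let $\sigma_{1,q}=\begin{bmatrix}q^{-1}&-q^{-1}\\0&1\end{bmatrix}$ and $\sigma_{2,q}=\begin{bmatrix}1&0\\1&q^{-1}\end{bmatrix}$ in $\mathrm{PSL}_2(\mathbb R)$, acting on $\mathbb R\cup\{\infty\}$ by fractional linear transformations $\begin{bmatrix}a&b\\c&d\end{bmatrix}z=\frac{az+b}{cz+d}$; $\sigma_i\mapsto\sigma_{i,q}$ defines a homomorphism from the braid group $B_3=\langle\sigma_1,\sigma_2\mid\sigma_1\sigma_2\sigma_1=\sigma_2\sigma_1\sigma_2\rangle$. Every nonzero finite rational $r/s$ has a unique expansion $r/s=[a_1,\dots,a_{2n}]=a_1+\cfrac{1}{a_2+\cfrac{1}{\ddots+\cfrac1{a_{2n}}}}$ with either $a_1\ge0$, $a_2,\dots,a_{2n}\ge1$, or $a_1\le0$, $a_2,\dots,a_{2n}\le-1$ (integers); $0$ has expansion $[-1,1]$ and $\infty$ the empty expansion. For such $\mathbf a$ let $\beta_{\mathbf a}=\sigma_1^{-a_1}\sigma_2^{a_2}\cdots\sigma_1^{-a_{2n-1}}\sigma_2^{a_{2n}}$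 and $\beta_{\mathbf a,q}$ its image in $\mathrm{PSL}_2(\mathbb R)$. The right $q$-deformed rational is $[r/s]^\sharp_q=\beta_{\mathbf a,q}(\infty)$ and the left $q$-deformed rational is $[r/s]^\flat_q=\beta_{\mathbf a,q}(1/(1-q))$. *)

(* Defs.v *)
From HB Require Import structures.
From Stdlib Require Import ClassicalEpsilon.
From mathcomp Require Import all_boot all_order all_algebra.
From mathcomp Require Import all_classical all_reals all_analysis.
Set Implicit Arguments. Unset Strict Implicit. Unset Printing Implicit Defensive.
Import Order.TTheory GRing.Theory Num.Theory.
Import numFieldNormedType.Exports.
Local Open Scope classical_set_scope.
Local Open Scope ring_scope.

Fixpoint cf_val (a : seq int) : rat :=
  match a with
  | [::] => 0
  | [:: a1] => a1%:~R
  | a1 :: l => a1%:~R + (cf_val l)^-1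
  end.

Definition is_expansion (a : seq int) (x : rat) : Prop :=
  (x = 0 /\ a = [:: -1; 1]%R)
  \/ (x <> 0 /\ (0 < size a)%N /\ ~~ odd (size a) /\
      ((0 <= head 0 a /\ all (fun k => 1 <= k) (behead a)) \/
       (head 0 a <= 0 /\ all (fun k => k <= -1) (behead a))) /\
      cf_val a = x).

(* The (unique) expansion of x, chosen by Hilbert's epsilon. *)
Definition cf_exp (x : rat) : seq int :=
  epsilon (inhabits [::]) (fun a => is_expansion a x).

Section Deform.
Variable R : realType.

Definition sigma1 (q : R) : 'M[R]_2 :=
  \matrix_(i < 2, j < 2)
    (if (i : nat) == 0%N then (if (j : nat) == 0%N then q^-1 else - q^-1)
     else (if (j : nat) == 0%N then 0 else 1)).

Definition sigma2 (q : R) : 'M[R]_2 :=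
  \matrix_(i < 2, j < 2)
    (if (i : nat) == 0%N then (if (j : nat) == 0%N then 1 else 0)
     else (if (j : nat) == 0%N then 1 else q^-1)).

Definition mpowz (M : 'M[R]_2) (k : int) : 'M[R]_2 :=
  match k with
  | Posz n => M ^+ n
  | Negz n => (invmx M) ^+ n.+1
  end.

Fixpoint beta (q : R) (a : seq int) : 'M[R]_2 :=
  match a with
  | a1 :: a2 :: l => mpowz (sigma1 q) (- a1) *m mpowz (sigma2 q) a2 *m beta q l
  | [:: a1] => mpowz (sigma1 q) (- a1)
  | [::] => 1%:M
  end.

(* Points of RP^1 = R u {oo} in homogeneous coordinates (u, v) ~ u / v;   *)
(* oo = (1, 0).  Fractional linear action of a matrix.                    *)
Definition act (M : 'M[R]_2) (P : R * R) : R * R :=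
  (M 0 0 * P.1 + M 0 1 * P.2, M 1 0 * P.1 + M 1 1 * P.2).

Definition infty : R * R := (1, 0).

Definition qsharp (q : R) (x : rat) : R * R := act (beta q (cf_exp x)) infty.
Definition qflat (q : R) (x : rat) : R * R :=
  act (beta q (cf_exp x)) (1 / (1 - q), 1).

(* Homeomorphism RP^1 -> unit circle (u:v) |-> angle doubling; used to    *)
(* define convergence in R u {oo}.                                        *)
Definition chord (P : R * R) : R * R :=
  let n := P.1 ^+ 2 + P.2 ^+ 2 in
  ((P.1 ^+ 2 - P.2 ^+ 2) / n, 2 * P.1 * P.2 / n).

Definition pconv (P : nat -> R * R) (L : R * R) : Prop :=
  L <> (0, 0) /\
  (fun m : nat => (chord (P m)).1 : R) @ \oo --> ((chord L).1 : R) /\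
  (fun m : nat => (chord (P m)).2 : R) @ \oo --> ((chord L).2 : R).

End Deform.

(* Main.v *)
(* On [0, oo) both z |-> q z + 1 (the action of sigma1^-1) and
   z |-> q z / (q z + 1) (the action of sigma2) contract the Euclidean metric by
   the factor q and preserve [0, 1/(1 - q)]. A positive rational is obtained from
   0 by a word in the maps z + 1 and z / (z + 1), and its right q-deformation by
   the same word in the q-deformed maps. Two rationals close to an irrational t
   share a long prefix, so their q-deformations are exponentially close; from the
   right the same holds at a rational t. If x tends to y = w(1) from the left, then
   x = w(z / (z + 1)) with z -> oo, and the q-deformation of z tends to 1/(1 - q).
   The coordinate change z |-> -1/(q z) interchanges the actions of sigma1 and
   sigma2 and reduces negative rationals to positive ones. *)
Require Import Defs.
From Stdlib Require ClassicalEpsilon.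
From HB Require Import structures.
From mathcomp Require Import all_boot all_order all_algebra.
From mathcomp Require Import all_classical all_reals all_analysis.
From mathcomp Require Import ring lra zify.
Import Order.TTheory GRing.Theory Num.Theory.
Import numFieldNormedType.Exports.
Local Open Scope classical_set_scope.
Local Open Scope ring_scope.

(* The letters true and false stand for sigma1^-1, acting by z |-> q z + 1, and
   sigma2, acting by z |-> q z / (q z + 1); at q = 1 they give z + 1 and
   z / (z + 1). *)
Definition letter {K : fieldType} (q : K) (b : bool) (z : K) : K :=
  if b then q * z + 1 else q * z / (q * z + 1).

Definition wact {K : fieldType} (q z : K) (w : seq bool) : K :=
  foldr (letter q) z w.

(** The estimates below are for words applied to 0, while rationals arise as words applied to 1; a
    final letter true passes between the two. *)
Lemma wact_rcons (K : fieldType) (q : K) (w : seq bool) :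
  wact q 0 (rcons w true) = wact q 1 w.
Proof. by rewrite /wact foldr_rcons /= mulr0 add0r. Qed.

Lemma wact_cat (K : fieldType) (q z : K) w w' :
  wact q z (w ++ w') = wact q (wact q z w') w.
Proof. exact: foldr_cat. Qed.

Lemma wact1_gt0 (R : realType) w : 0 < wact (1 : R) 1 w.
Proof.
elim: w => //= b w IH; rewrite /letter mul1r.
by case: b; rewrite ?divr_gt0 // addr_gt0.
Qed.

(** * Contraction by the letters on the half-line *)

Section Contraction.
Variables (R : realType) (q : R).
Hypotheses (q_gt0 : 0 < q) (q_lt1 : q < 1).

(** The fixed point of [z |-> q z + 1], and the limit of the q-integers [1 + q + ... + q^(n-1)]. *)
Let C : R := 1 / (1 - q).

Lemma fixpoint_gt0 : 0 < C.
Proof. by rewrite divr_gt0 // subr_gt0. Qed.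

Lemma fixpointE : q * C + 1 = C.
Proof. by rewrite /C; field; rewrite subr_eq0 gt_eqF. Qed.

Lemma letter_ge0 (p : R) b z : 0 < p -> 0 <= z -> 0 <= letter p b z.
Proof.
move=> p0 z0; have pz : 0 <= p * z by rewrite mulr_ge0 // ltW.
by case: b; rewrite /letter ?addr_ge0 // divr_ge0 // addr_ge0.
Qed.

Lemma letter_le b (z : R) : 0 <= z -> z <= C -> letter q b z <= C.
Proof.
move=> z0 zC; have qz : q * z <= q * C by rewrite ler_pM2l.
have qz0 : 0 <= q * z by rewrite mulr_ge0 // ltW.
have := fixpointE; have := fixpoint_gt0 => C0 CE.
case: b; rewrite /letter; first by lra.
rewrite ler_pdivrMr; last by lra.
nra.
Qed.

Lemma letter_contract b (z z' : R) : 0 <= z -> 0 <= z' ->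
  `|letter q b z - letter q b z'| <= q * `|z - z'|.
Proof.
move=> z0 z'0; case: b; rewrite /letter.
  by rewrite [X in `|X|](_ : _ = q * (z - z')) ?normrM ?(gtr0_norm q_gt0) //; ring.
have d0 : 0 < q * z + 1 by rewrite ltr_wpDl // mulr_ge0 // ltW.
have d'0 : 0 < q * z' + 1 by rewrite ltr_wpDl // mulr_ge0 // ltW.
(* Both denominators are at least 1 on the half-line, so dividing [q (z - z')] by them only shrinks
   it. *)
have -> : q * z / (q * z + 1) - q * z' / (q * z' + 1)
   = q * (z - z') / ((q * z + 1) * (q * z' + 1)).
  by field; rewrite !gt_eqF.
have dd0 : 0 < (q * z + 1) * (q * z' + 1) by rewrite mulr_gt0.
rewrite normrM normfV (gtr0_norm dd0) ler_pdivrMr // normrM (gtr0_norm q_gt0).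
rewrite ler_peMr ?(mulr_ge0 (ltW q_gt0)) //.
have a0 : 0 <= q * z by rewrite mulr_ge0 // ltW.
have b0 : 0 <= q * z' by rewrite mulr_ge0 // ltW.
by have := mulr_ge0 a0 b0; lra.
Qed.

Lemma wact_ge0 (p z : R) w : 0 < p -> 0 <= z -> 0 <= wact p z w.
Proof. by move=> p0 z0; elim: w => //= b w IH; exact: letter_ge0. Qed.

Lemma wact_le z w : 0 <= z -> z <= C -> wact q z w <= C.
Proof.
by move=> z0 zC; elim: w => //= b w IH; apply: letter_le => //; exact: wact_ge0.
Qed.

Lemma wact0_itv w : 0 <= wact q 0 w <= C.
Proof. by rewrite wact_ge0 // wact_le // ltW // fixpoint_gt0. Qed.

(** * Deformed value [F] against classical value [X] *)

Notation X w := (wact (1 : R) 0 w).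
Notation F w := (wact q 0 w).

Lemma X_ge0 w : 0 <= X w. Proof. exact: wact_ge0. Qed.

Lemma X_true w : X (true :: w) = X w + 1.
Proof. by rewrite /= mul1r. Qed.

Lemma X_false w : X (false :: w) = X w / (X w + 1).
Proof. by rewrite /= mul1r. Qed.

Lemma X_false_lt1 w : X (false :: w) < 1.
Proof.
by rewrite X_false; have := X_ge0 w => h; rewrite ltr_pdivrMr; lra.
Qed.

(* The empty word is covered because the letter false fixes 0. *)
Lemma wact_lt1 w : X w < 1 ->
  exists v, [/\ X w = X (false :: v) & F w = F (false :: v)].
Proof.
case: w => [|[] w]; last by exists w.
  by move=> _; exists [::]; rewrite /= !mulr0 !mul0r.
by rewrite X_true; have := X_ge0 w; lra.
Qed.

Lemma wact_ge1 w : 1 <= X w -> exists v, w = true :: v.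
Proof.
case: w => [|[] w]; [by rewrite /= ler10|by exists w|].
by rewrite leNgt X_false_lt1.
Qed.

(** The map [x / (1 - x)] inverts the letter false at q = 1; it gives the value left after a leading
    false is stripped. *)
Lemma moebius_cancel (x : R) : 0 <= x -> x = (x / (x + 1)) / (1 - x / (x + 1)).
Proof. by move=> x0; field; lra. Qed.

Lemma moebius_continuous (t e : R) : t < 1 -> 0 < e ->
  exists2 d, 0 < d & forall x, x < 1 -> `|x - t| < d ->
    `|x / (1 - x) - t / (1 - t)| < e.
Proof.
move=> t1 e0; set u := 1 - t; have u0 : 0 < u by rewrite subr_gt0.
(* The first bound keeps [(1 - x) * u] above [u ^+ 2 / 2]; the second is [e] times that quantity. *)
exists (Num.min (u / 2) (e * u ^+ 2 / 2)).
  by rewrite lt_min !divr_gt0 // mulr_gt0 // exprn_gt0.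
move=> x x1; rewrite lt_min => /andP[d1 d2].
have x0 : u / 2 < 1 - x.
  by move: d1; rewrite ltr_norml /u => /andP[]; lra.
have x0' : 0 < 1 - x by lra.
have -> : x / (1 - x) - t / u = (x - t) / ((1 - x) * u).
  by rewrite /u; field; rewrite -/u; lra.
rewrite normrM normfV (@ger0_norm _ (_ * u)); last by rewrite mulr_ge0 ?ltW.
rewrite ltr_pdivrMr ?mulr_gt0 //; apply: lt_le_trans d2 _.
rewrite -mulrA ler_pM2l //; nra.
Qed.

(* Two-sided at t outside the orbit of 0, but only to the right of a t in it. *)
Lemma oscillation n (t : R) : 0 <= t -> exists2 d, 0 < d & forall w w',
  `|X w - t| < d -> t <= X w \/ (forall v, X v <> t) ->
  `|X w' - t| < d -> t <= X w' \/ (forall v, X v <> t) ->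
  `|F w - F w'| <= C * q ^+ n.
Proof.
elim: n t => [|n IH] t t0.
  exists 1 => // w w' _ _ _ _; rewrite expr0 mulr1.
  by have := wact0_itv w; have := wact0_itv w'; rewrite ler_norml; lra.
have step b w w' : `|F w - F w'| <= C * q ^+ n ->
    `|F (b :: w) - F (b :: w')| <= C * q ^+ n.+1.
  move=> h; apply: le_trans (letter_contract _ _ _ _ _) _; rewrite ?wact_ge0 //.
  by rewrite exprS mulrCA ler_pM2l.
have [t1|t1] := leP 1 t.
  have [|d d0 Hd] := IH (t - 1); first by rewrite subr_ge0.
  pose d' := if t == 1 then d else Num.min d (t - 1).
  have d'0 : 0 < d'.
    by rewrite /d'; case: eqVneq => // t1'; rewrite lt_min d0 subr_gt0 lt_neqAle eq_sym t1'.
  exists d' => // w w' hw cw hw' cw'.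
  have red v : `|X v - t| < d' -> t <= X v \/ (forall v, X v <> t) ->
    exists2 v', v = true :: v' & `|X v' - (t - 1)| < d /\
      (t - 1 <= X v' \/ (forall v, X v <> t - 1)).
    move=> hv cv; have v1 : 1 <= X v.
      case: cv => [|cv]; first exact: le_trans.
      move: hv; rewrite /d'; case: eqVneq => [tE|_].
        by case: (cv [:: true]); rewrite X_true /= add0r.
      by rewrite lt_min => /andP[_]; rewrite ltr_norml => /andP[]; lra.
    have [v' vE] := wact_ge1 v v1; exists v' => //.
    move: hv cv; rewrite vE X_true => hv cv; split.
      have -> : X v' - (t - 1) = X v' + 1 - t by lra.
      apply: lt_le_trans hv _; rewrite /d'; case: eqP => // _.
      by rewrite ge_min lexx.
    case: cv => cv; [by left; lra|right=> u uE; apply: (cv (true :: u))].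
    by rewrite X_true uE; lra.
  have [v -> [? ?]] := red w hw cw; have [v' -> [? ?]] := red w' hw' cw'.
  by apply: step; apply: Hd.
have [|d d0 Hd] := IH (t / (1 - t)); first by rewrite divr_ge0 // subr_ge0 ltW.
have [d1 d10 Hd1] := moebius_continuous _ _ t1 d0.
(* The margin [1 - t] keeps [X v] below 1, so the first letter may be taken to be false. *)
exists (Num.min d1 (1 - t)); first by rewrite lt_min d10 subr_gt0.
move=> w w' hw cw hw' cw'.
have red v : `|X v - t| < Num.min d1 (1 - t) -> t <= X v \/ (forall v, X v <> t) ->
  exists2 v', F v = F (false :: v') & `|X v' - t / (1 - t)| < d /\
    (t / (1 - t) <= X v' \/ (forall v, X v <> t / (1 - t))).
  rewrite lt_min => /andP[hv hv'] cv.
  have v1 : X v < 1 by move: hv'; rewrite ltr_norml; lra.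
  have [v' [vX vF]] := wact_lt1 _ v1; exists v' => //.
  have v'E : X v' = X v / (1 - X v).
    by rewrite vX X_false -moebius_cancel // X_ge0.
  split; first by rewrite v'E; apply: Hd1.
  case: cv => [cv|cv].
    left; rewrite v'E ler_pdivrMr ?subr_gt0 // mulrAC ler_pdivlMr ?subr_gt0 //.
    by lra.
  right=> u uE; apply: (cv (false :: u)).
  by rewrite X_false uE; field; lra.
have [v -> [? ?]] := red w hw cw; have [v' -> [? ?]] := red w' hw' cw'.
by apply: step; apply: Hd.
Qed.

(** A value of at least [n] forces [n] leading letters true, and each contracts towards their fixed
    point [C]. *)
Lemma at_infinity n w : n%:R <= X w -> `|F w - C| <= C * q ^+ n.
Proof.
elim: n w => [|n IH] w.
  by move=> _; have := wact0_itv w; rewrite expr0 mulr1 ler_norml; lra.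
rewrite -natr1 => hw; have [|v E] := wact_ge1 w.
  by apply: le_trans hw; rewrite lerDr.
move: hw; rewrite E X_true lerD2r => /IH {}IH.
have -> : F (true :: v) - C = letter q true (F v) - letter q true C.
  by rewrite /= /letter fixpointE.
apply: le_trans (letter_contract _ _ _ _ _) _; rewrite ?wact_ge0 //.
  exact/ltW/fixpoint_gt0.
by rewrite exprS mulrCA ler_pM2l.
Qed.

Lemma geometric_small (e : R) : 0 < e -> exists n, C * q ^+ n < e.
Proof.
move=> e0; have q1 : `|q| < 1 by rewrite ger0_norm // ltW.
have /cvgrPdist_lt /(_ e e0) [n _ /(_ n (leqnn n))] := cvg_geometric C q1.
by rewrite /geometric /= sub0r normrN => /(le_lt_trans (ler_norm _)); exists n.
Qed.

(** Induction on [v] strips the letters shared with [w]. For empty [v] the point 1 is approached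
    from the left: [w] is false followed by a word of large value, so [F w] is close to
    [letter q false C = q]. *)
Lemma limit_left (v : seq bool) (e : R) : 0 < e -> exists2 d, 0 < d &
  forall w, `|X w - wact 1 1 v| < d -> X w < wact 1 1 v ->
    `|F w - wact q q v| < e.
Proof.
have step b w v' : `|F w - wact q q v'| < e ->
    `|F (b :: w) - wact q q (b :: v')| < e.
  move=> h; apply: le_lt_trans (letter_contract _ _ _ _ _) _.
  - exact: wact_ge0.
  - by apply: wact_ge0 => //; exact: ltW.
  by apply: le_lt_trans h; rewrite ler_piMl // ltW.
move=> e0; elim: v => [|[] v [d d0 Hd]].
- have [n nE] := geometric_small e e0.
  (* Since [x / (x + 1) = 1 - 1 / (x + 1)], being this close to 1 means [x > n]. *)
  exists (n.+1%:R^-1); first by rewrite invr_gt0.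
  move=> w /=; rewrite ltr_norml => /andP[h _] h1.
  have [v [vX vF]] := wact_lt1 _ h1.
  have qE : q = letter q false C by rewrite /letter fixpointE mulfK // gt_eqF // fixpoint_gt0.
  rewrite vF [Y in _ - Y]qE; apply: le_lt_trans nE.
  apply: le_trans (letter_contract _ _ _ _ _) _.
  - exact: wact_ge0.
  - exact/ltW/fixpoint_gt0.
  apply: (@le_trans _ _ `|F v - C|); first by rewrite ler_piMl // ltW.
  apply: at_infinity.
  have x0 := X_ge0 v; have x1 : 0 < X v + 1 by lra.
  have n1 : 0 < (n.+1%:R : R) by [].
  move: h; rewrite vX X_false.
  have -> : X v / (X v + 1) - 1 = - (X v + 1)^-1 by field; lra.
  by rewrite ltrN2 ltf_pV2 // -natr1 ltrD2r => /ltW.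
- have v0 := wact1_gt0 R v.
  (* The target exceeds 1 by [wact 1 1 v], so within this distance [w] begins with true. *)
  exists (Num.min d (wact 1 1 v)); first by rewrite lt_min d0.
  move=> w; rewrite lt_min /= mul1r => /andP[h h'] h1.
  have [|w' wE] := wact_ge1 w; first by move: h'; rewrite ltr_norml; lra.
  move: h h1; rewrite wE X_true => h h1; apply: step; apply: Hd; last by lra.
  by have -> : X w' - wact 1 1 v = X w' + 1 - (wact 1 1 v + 1) by lra.
set t := wact 1 1 (false :: v).
have v0 : 0 <= wact (1 : R) 1 v by apply: wact_ge0.
have tE : wact 1 1 v = t / (1 - t).
  by rewrite /t /= mul1r -moebius_cancel.
have t1 : t < 1 by rewrite /t /= mul1r ltr_pdivrMr; lra.
have [d' d'0 Hd'] := moebius_continuous _ _ t1 d0.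
exists d' => // w h h1.
have x1 := lt_trans h1 t1.
have [w' [wX wF]] := wact_lt1 _ x1.
have w'E : X w' = X w / (1 - X w) by rewrite wX X_false -moebius_cancel // X_ge0.
rewrite wF; apply: step; apply: Hd; rewrite w'E tE; first exact: Hd'.
rewrite ltr_pdivrMr ?subr_gt0 // mulrAC ltr_pdivlMr ?subr_gt0 //; lra.
Qed.

Lemma limit_right (w0 : seq bool) (e : R) : 0 < e -> exists2 d, 0 < d &
  forall w, `|X w - X w0| < d -> X w0 <= X w -> `|F w - F w0| < e.
Proof.
move=> e0; have [n nE] := geometric_small e e0.
have [d d0 Hd] := oscillation n _ (X_ge0 w0); exists d => // w h h0.
apply: le_lt_trans nE; apply: Hd => //; first by left.
- by rewrite subrr normr0.
- by left.
Qed.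

(** As [t] is not the value of a word, [oscillation] applies on both sides of [t] and yields a
    Cauchy condition. *)
Lemma limit_irrational (t : R) : 0 <= t -> (forall v, X v <> t) ->
  (forall d, 0 < d -> exists w, `|X w - t| < d) ->
  exists z, forall e, 0 < e -> exists2 d, 0 < d &
    forall w, `|X w - t| < d -> `|F w - z| < e.
Proof.
move=> t0 tX tdense.
(* The lower limit of F at t. *)
pose S := [set y : R | exists2 d, 0 < d & forall w, `|X w - t| < d -> y <= F w].
have S0 : S !=set0 by exists 0; exists 1 => // w _; exact: wact_ge0.
exists (sup S) => e e0; have [n nE] := geometric_small e e0.
have [d d0 Hd] := oscillation n _ t0; exists d => // w hw.
apply: le_lt_trans nE.
have close w' : `|X w' - t| < d -> `|F w - F w'| <= C * q ^+ n.
  by move=> h; apply: Hd => //; right.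
(* Density provides a word in both neighbourhoods at once, which compares the lower bound [y] with
   [F w]. *)
have ub : ubound S (F w + C * q ^+ n).
  move=> y [d' d'0 hy]; have [|w' hw'] := tdense (Num.min d d').
    by rewrite lt_min d0.
  move: hw'; rewrite lt_min => /andP[h h']; apply: le_trans (hy _ h') _.
  by move: (close _ h); rewrite ler_norml; lra.
have S1 : S (F w - C * q ^+ n).
  by exists d => // w' /close; rewrite ler_norml; lra.
have := ge_sup S0 ub; have := ub_le_sup (ex_intro _ _ ub) S1.
by rewrite ler_norml; lra.
Qed.

End Contraction.

(** * Continued fractions and their words *)

Definition signed (s : bool) (n : nat) : int := if s then n%:Z else - n%:Z.

(** The absolute values of the digits of a nonzero rational; their common sign is kept apart in
    [signed]. *)
Definition regular (l : seq nat) : bool :=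
  [&& l != [::], ~~ odd (size l) & all (leq 1) (behead l)].

(* Since the letter false maps oo to 1 at every q, the last exponent is lowered by one and the word
   acts on 1 instead of oo. *)
Fixpoint cfword (b : bool) (l : seq nat) : seq bool :=
  match l with
  | n1 :: n2 :: l' =>
      nseq n1 b ++ (if l' is [::] then nseq n2.-1 (~~ b)
                    else nseq n2 (~~ b) ++ cfword b l')
  | _ => [::]
  end.

(** Consumes digits in pairs, as [beta] and [cfword] do. *)
Lemma regular_ind (P : seq nat -> Prop) :
  (forall n1 n2, P [:: n1; n2.+1]) ->
  (forall n1 n2 l, regular l -> P l -> P [:: n1, n2.+1 & l]) ->
  forall l, regular l -> P l.
Proof.
move=> P0 PS l; have [k] := ubnP (size l); elim: k l => // k IH.
case=> [|n1 [|n2 l]] //= hk; rewrite /regular /= negbK => /andP[h1 /andP[h2 h3]].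
case: n2 h2 => // n2 _; case: l hk h1 h3 => [|n3 [|n4 l]] //= hk h1 /andP[_ h3].
apply: PS; [|apply: IH]; rewrite /regular /= ?h1 ?h3 //; lia.
Qed.

(** The convention [0^-1 = 0] absorbs the singleton case of [cf_val]. *)
Lemma cf_val_cons (a : int) (l : seq int) :
  cf_val (a :: l) = a%:~R + (cf_val l)^-1.
Proof. by case: l => //=; rewrite invr0 addr0. Qed.

Lemma cf_val_signed s l :
  cf_val (map (signed s) l) = if s then cf_val (map Posz l) else - cf_val (map Posz l).
Proof.
case: s => //; elim: l => [|n l IH]; first by rewrite oppr0.
by rewrite !map_cons !cf_val_cons IH invrN /= mulrNz opprD.
Qed.

Lemma cf_val_regular_gt0 l : regular l -> 0 < cf_val (map Posz l).
Proof.
move: l; apply: regular_ind => [n1 n2|n1 n2 l _ IH]; rewrite !map_cons !cf_val_cons.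
  by rewrite invr0 addr0 ltr_wpDl // invr_gt0.
by rewrite ltr_wpDl // invr_gt0 ltr_wpDl // invr_gt0.
Qed.

(** The letter true raises the first digit. Since [x / (x + 1) = 1 / (1 + 1 / x)], the letter false
    raises the second digit if the first is 0, and otherwise prepends the digits 0, 1. *)
Lemma regular_letter l b : regular l -> exists2 l', regular l' &
  cf_val (map Posz l') = letter 1 b (cf_val (map Posz l)).
Proof.
move=> hr; have x0 := cf_val_regular_gt0 _ hr; case: l hr x0 => [|n1 [|n2 l]] // hr x0.
case: b.
  exists [:: n1.+1, n2 & l] => //.
  by rewrite /letter mul1r !map_cons !cf_val_cons -addn1 PoszD intrD addrAC.
rewrite /letter mul1r; case: n1 hr x0 => [|n1] hr x0.
  exists [:: 0, n2.+1 & l]%N; first by move: hr; rewrite /regular /= => /and3P[-> _ ->].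
  move: x0; rewrite !map_cons !cf_val_cons !add0r invr_gt0 -[n2.+1]addn1 PoszD intrD.
  by rewrite addrAC; move: (_ + _^-1) => y y0; field; lra.
exists [:: 0, 1, n1.+1, n2 & l]%N.
  by move: hr; rewrite /regular /= !negbK.
rewrite 2![in LHS](map_cons, cf_val_cons) 2![in LHS](map_cons, cf_val_cons).
by move: x0; move: (cf_val _) => x x0; rewrite add0r; field; lra.
Qed.

(** Subtractive Euclidean algorithm: each subtraction undoes one letter. *)
Lemma regular_exists (x : rat) : 0 < x ->
  exists2 l, regular l & cf_val (map Posz l) = x.
Proof.
move=> x0; have [m [n [m0 n0 ->]]] : exists m n, [/\ (0 < m)%N, (0 < n)%N & x = m%:R / n%:R].
  exists `|numq x|%N, `|denq x|%N; rewrite !absz_gt0 numq_eq0 denq_neq0 gt_eqF //.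
  by split=> //; rewrite !natr_absz !ger0_norm ?numq_ge0 ?denq_ge0 ?divq_num_den // ltW.
have [k] := ubnP (m + n); elim: k m n m0 n0 => // k IH m n m0 n0 hk.
have m1 : 0 < (m%:R : rat) by rewrite ltr0n.
have n1 : 0 < (n%:R : rat) by rewrite ltr0n.
have [mn|mn|mn] := ltngtP m n.
- have [|||l hl lE] := IH m (n - m)%N => //; try lia.
  have [l' hl' lE'] := regular_letter _ false hl; exists l' => //.
  rewrite lE' lE /letter mul1r natrB ?(ltnW mn) //.
  have : (m%:R : rat) < n%:R by rewrite ltr_nat.
  by move=> h; field; lra.
- have [|||l hl lE] := IH (m - n)%N n => //; try lia.
  have [l' hl' lE'] := regular_letter _ true hl; exists l' => //.
  rewrite lE' lE /letter mul1r natrB ?(ltnW mn) //.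
  by field; lra.
by exists [:: 0; 1]%N => //; rewrite mn divff // gt_eqF.
Qed.

(** An expansion exists by [regular_exists], so the epsilon choice is one. Regular lists have
    positive value, so the sign of the digits is that of [x]. *)
Lemma cf_exp_signed (x : rat) : x <> 0 ->
  exists2 l, regular l &
    cf_exp x = map (signed (0 < x)) l /\ cf_val (map Posz l) = `|x|.
Proof.
move=> x0.
have key s a : (0 < size a)%N -> ~~ odd (size a) ->
    (0 <= if s then head 0 a else - head 0 a) ->
    all (fun k => 1 <= if s then k else - k) (behead a) -> cf_val a = x ->
    exists2 l, regular l &
      a = map (signed (0 < x)) l /\ cf_val (map Posz l) = `|x|.
  move=> a1 a2 a3 a4 aE; have hl : regular (map absz a).
    rewrite /regular size_map -size_eq0 size_map -lt0n a1 a2 /= behead_map all_map.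
    by apply: sub_all a4 => k /=; case: s {a3} => /=; lia.
  have aS : a = map (signed s) (map absz a).
    rewrite -map_comp; case: a a1 a3 a4 {a2 aE hl} => //= a0 a _ a3 a4; congr (_ :: _).
      by rewrite /signed; case: s a3 {a4} => /=; lia.
    rewrite -[LHS]map_id; apply/eq_in_map => k /(allP a4).
    by rewrite /signed; case: s {a3 a4} => /=; lia.
  exists (map absz a) => //; have y0 := cf_val_regular_gt0 _ hl.
  move: aE; rewrite {1}aS cf_val_signed => xE.
  have -> : (0 < x) = s by case: s xE {a3 a4 aS} => <-; rewrite ?oppr_gt0 // lt_gtF.
  by split=> //; rewrite -xE; case: s {a3 a4 aS xE}; rewrite ?normrN gtr0_norm.
have : is_expansion (cf_exp x) x.
  apply: (ClassicalEpsilon.epsilon_spec _ (fun a => is_expansion a x)).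
  have [|l hl lE] := regular_exists `|x|; first by rewrite normr_gt0; apply/eqP.
  exists (map (signed (0 < x)) l); right; split=> //; rewrite size_map cf_val_signed lE.
  move: hl; rewrite /regular => /and3P[h1 h2 h3]; split; first by rewrite lt0n size_eq0.
  split=> //; split; last first.
    by case: ltP => h; [rewrite gtr0_norm|rewrite ler0_norm // opprK].
  rewrite behead_map !all_map; case: (0 < x); [left|right]; split.
  - by case: l {h1 h2 h3 lE}.
  - by apply: sub_all h3 => k /=.
  - by case: l {h1 h2 h3 lE} => //= k l; rewrite oppr_le0.
  - by apply: sub_all h3 => k /=; rewrite /signed; lia.
case=> [[]//|[_ [h1 [h2 [h3 h4]]]]].
case: h3 => -[h5 h6]; [apply: (key true)|apply: (key false)] => //.
  by rewrite oppr_ge0.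
by apply: sub_all h6 => k; lia.
Qed.

(** * Values of words at q = 1 *)

Section Value.
Variable R : realType.

Lemma wact_nseq_true n (z : R) : wact 1 z (nseq n true) = n%:R + z.
Proof.
by elim: n => [|n IH] /=; rewrite ?add0r // IH /letter mul1r -natr1 addrAC.
Qed.

(** In the coordinate [z^-1] the letter false is translation by 1, so alternating blocks of letters
    are continued fraction steps. *)
Lemma wact_nseq_false n (z : R) : 0 < z ->
  wact 1 z (nseq n false) = (n%:R + z^-1)^-1.
Proof.
move=> z0; have zV : 0 < z^-1 by rewrite invr_gt0.
elim: n => [|n IH] /=; first by rewrite add0r invrK.
have n0 : 0 <= (n%:R : R) by [].
rewrite IH /letter mul1r -natr1; move: zV; move: (z^-1) => y y0.
by field; lra.
Qed.

Lemma wact_cfword l : regular l ->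
  ratr (cf_val (map Posz l)) = wact (1 : R) 1 (cfword true l).
Proof.
move: l; apply: regular_ind => [n1 n2|n1 n2 l hl IH].
  rewrite !map_cons !cf_val_cons invr0 addr0 /= wact_cat wact_nseq_true.
  (* The starting point 1 restores the unit removed from the last exponent. *)
  by rewrite wact_nseq_false // invr1 natr1 rmorphD fmorphV !rmorph_int.
rewrite !map_cons !cf_val_cons; case: l hl IH => [|n3 l] // hl IH.
rewrite (_ : cfword _ _ = nseq n1 true ++ nseq n2.+1 false ++ cfword true (n3 :: l)) //.
rewrite !wact_cat wact_nseq_true wact_nseq_false ?wact1_gt0 //.
by rewrite -IH !(rmorphD, fmorphV) !rmorph_int.
Qed.

(** At q = 1, inversion fixes 1 and interchanges the two letters. *)
Lemma wact_negb w : wact (1 : R) 1 (map negb w) = (wact 1 1 w)^-1.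
Proof.
elim: w => [|b w IH] /=; first by rewrite invr1.
have := wact1_gt0 R w; rewrite IH /letter mul1r; move: (wact _ _ _) => x x0.
by case: b => /=; field; lra.
Qed.
End Value.

Lemma cfword_negb b l : cfword (~~ b) l = map negb (cfword b l).
Proof.
have [k] := ubnP (size l); elim: k l => // k IH [|n1 [|n2 [|n3 l]]] //= hk.
  by rewrite map_cat !map_nseq.
rewrite !map_cat !map_nseq -/(cfword (~~ b) (n3 :: l)) -/(cfword b (n3 :: l)).
by rewrite IH //=; lia.
Qed.

(** * Matrix action in homogeneous coordinates *)

Section Matrices.
Variables (R : realType) (q : R).
Hypotheses (q_gt0 : 0 < q) (q_lt1 : q < 1).

Let q_neq0 : q != 0. Proof. by rewrite gt_eqF. Qed.

Definition proportional (P Q : R * R) : Prop :=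
  exists2 c, c != 0 & P = (c * Q.1, c * Q.2).

Lemma proportional_trans P Q S :
  proportional P Q -> proportional Q S -> proportional P S.
Proof.
move=> [c c0 ->] [d d0 ->]; exists (c * d); first by rewrite mulf_neq0.
by rewrite /= !mulrA.
Qed.

Lemma proportional_sym P Q : proportional P Q -> proportional Q P.
Proof.
move=> [c c0 ->]; exists c^-1; first by rewrite invr_neq0.
by rewrite /= !mulKf //; case: Q.
Qed.

Lemma proportional_act M P Q :
  proportional P Q -> proportional (act M P) (act M Q).
Proof. by move=> [c c0 ->]; exists c => //; rewrite /act /=; congr pair; ring. Qed.

Lemma act_mul (M N : 'M[R]_2) P : act (M *m N) P = act M (act N P).
Proof.
have sum2 (f : 'I_2 -> R) : \sum_i f i = f 0 + f 1.
  by rewrite !big_ord_recl big_ord0 addr0; congr (_ + f _); apply/val_inj.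
by rewrite /act !mxE !sum2 /=; congr pair; ring.
Qed.

Lemma act1 P : act (1%:M : 'M[R]_2) P = P.
Proof. by case: P => x y; rewrite /act !mxE /= !mul0r !mul1r addr0 add0r. Qed.

(** Inverse generators can thus be checked through the generators, without the entries of
    [invmx]. *)
Lemma act_invmx (M : 'M[R]_2) P Q : M \in unitmx ->
  proportional (act M P) Q -> proportional (act (invmx M) Q) P.
Proof.
move=> Mu /proportional_sym /(proportional_act (invmx M)).
by rewrite -act_mul mulVmx // act1.
Qed.

Lemma unitmx2 (M : 'M[R]_2) :
  M 0 0 * M 1 1 - M 0 1 * M 1 0 != 0 -> M \in unitmx.
Proof.
have E1 : lift 0 0 = 1 :> 'I_2 by apply/val_inj.
have E0 : lift 1 0 = 0 :> 'I_2 by apply/val_inj.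
rewrite unitmxE unitfE (expand_det_row _ 0) !big_ord_recl big_ord0 /cofactor.
by rewrite !det_mx11 !mxE !E1 !E0 /= addr0 expr0 expr1 mul1r mulN1r mulrN.
Qed.

Lemma sigma1_unit : sigma1 q \in unitmx.
Proof. by apply: unitmx2; rewrite !mxE /= mulr0 subr0 mulr1 invr_neq0. Qed.

Lemma sigma2_unit : sigma2 q \in unitmx.
Proof. by apply: unitmx2; rewrite !mxE /= mul0r subr0 mul1r invr_neq0. Qed.

Lemma act_sigma1 P : act (sigma1 q) P = (q^-1 * P.1 - q^-1 * P.2, P.2).
Proof. by rewrite /act !mxE /= mul0r mul1r add0r mulNr. Qed.

Lemma act_sigma2 P : act (sigma2 q) P = (P.1, P.1 + q^-1 * P.2).
Proof. by rewrite /act !mxE /= mul0r !mul1r addr0. Qed.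

(* Negative points are represented as -1/(q z) with z >= 0; in this coordinate
   sigma1 acts as the letter false and sigma2^-1 as the letter true. *)
Definition chart (s : bool) (z : R) : R * R := if s then (z, 1) else (-1, q * z).

(** The generator acting as the letter [b] in chart [s]. The letter [s] always belongs to sigma1, so
    words for digits of sign [s] start with the letter [s]. *)
Definition gen (s b : bool) : 'M[R]_2 :=
  if b == s then mpowz (sigma1 q) (signed (~~ s) 1)
  else mpowz (sigma2 q) (signed s 1).

Lemma act_gen s b z : 0 <= z ->
  proportional (act (gen s b) (chart s z)) (chart s (letter q b z)).
Proof.
move=> z0; have d0 : q * z + 1 != 0.
  by rewrite gt_eqF // ltr_wpDl // mulr_ge0 // ltW.
case: s; case: b; rewrite /gen /chart /letter /mpowz /= expr1.
- apply: act_invmx; first exact: sigma1_unit.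
  by exists 1; rewrite ?oner_eq0 // act_sigma1 /=; congr pair; field.
- exists ((q * z + 1) / q); first by rewrite mulf_neq0 ?invr_neq0.
  by rewrite act_sigma2 /=; congr pair; field; rewrite ?d0.
- apply: act_invmx; first exact: sigma2_unit.
  by exists 1; rewrite ?oner_eq0 // act_sigma2 /=; congr pair; field.
exists ((q * z + 1) / q); first by rewrite mulf_neq0 ?invr_neq0.
by rewrite act_sigma1 /=; congr pair; field; rewrite ?d0.
Qed.

Lemma act_gen_exp s b n z : 0 <= z ->
  proportional (act (gen s b ^+ n) (chart s z)) (chart s (wact q z (nseq n b))).
Proof.
move=> z0; elim: n => [|n IH].
  by rewrite expr0 act1; exists 1; rewrite ?oner_eq0 // !mul1r; case: chart.
rewrite exprS act_mul; apply: proportional_trans (proportional_act _ _ _ IH) _.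
by apply: act_gen; exact: wact_ge0.
Qed.

Lemma mpowz_signed (M : 'M[R]_2) s n :
  mpowz M (signed s n) = mpowz M (signed s 1) ^+ n.
Proof. by case: s; rewrite /signed /mpowz ?expr1 //; case: n => [|n] //=; rewrite expr1. Qed.

Lemma beta_cons s n1 n2 l : beta q (map (signed s) [:: n1, n2 & l]) =
  gen s s ^+ n1 *m gen s (~~ s) ^+ n2 *m beta q (map (signed s) l).
Proof.
rewrite /= /gen eqxx (_ : (~~ s == s) = false); last by case: s.
rewrite -!mpowz_signed; congr (mpowz _ _ *m _ *m _).
by case: s => //=; rewrite opprK.
Qed.

(** [P] itself may lie outside the nonnegative part of the chart; only its image under the rightmost
    generator must lie there. This covers both oo and [1 / (1 - q)]. *)
Lemma act_beta s l P z : regular l -> 0 <= z ->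
  proportional (act (gen s (~~ s)) P) (chart s z) ->
  proportional (act (beta q (map (signed s) l)) P)
               (chart s (wact q z (cfword s l))).
Proof.
move=> hl z0 hP; move: l hl; apply: regular_ind => [n1 n2|n1 n2 l hl IH].
  rewrite beta_cons mulmx1 act_mul exprSr act_mul /= wact_cat.
  apply: proportional_trans (act_gen_exp _ _ _ _ (wact_ge0 _ _ _ _ q_gt0 z0)).
  apply: proportional_act; apply: proportional_trans (act_gen_exp _ _ _ _ z0).
  exact: proportional_act.
rewrite beta_cons; case: l hl IH => [|n3 l] // hl IH.
rewrite (_ : cfword _ _ = nseq n1 s ++ nseq n2.+1 (~~ s) ++ cfword s (n3 :: l)) //.
rewrite !act_mul !wact_cat.
apply: proportional_trans (act_gen_exp _ _ _ _ (wact_ge0 _ _ _ _ q_gt0 (wact_ge0 _ _ _ _ q_gt0 z0))).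
apply: proportional_act; apply: proportional_trans (act_gen_exp _ _ _ _ (wact_ge0 _ _ _ _ q_gt0 z0)).
exact: proportional_act.
Qed.

Lemma act_gen_infty s : proportional (act (gen s (~~ s)) (infty R)) (chart s 1).
Proof.
case: s; rewrite /gen /mpowz /= expr1.
  by exists 1; rewrite ?oner_eq0 // act_sigma2 /infty /= !mul1r mulr0 addr0.
apply: act_invmx; first exact: sigma2_unit.
by exists (-1); rewrite ?oppr_eq0 ?oner_eq0 // act_sigma2 /infty /=; congr pair; field.
Qed.

(** For positive sign this is [q C / (q C + 1) = q]. For negative sign [1 / (1 - q)] has coordinate
    [-(1 - q) / q], which [z |-> q z + 1] sends to [q]. *)
Lemma act_gen_flat s :
  proportional (act (gen s (~~ s)) (1 / (1 - q), 1)) (chart s q).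
Proof.
have q1 : 1 - q != 0 by rewrite subr_eq0 gt_eqF.
case: s; rewrite /gen /mpowz /= expr1.
  exists (1 / (q * (1 - q))); first by rewrite mul1r invr_neq0 // mulf_neq0.
  by rewrite act_sigma2 /=; congr pair; field; rewrite ?q1.
apply: act_invmx; first exact: sigma2_unit.
exists (q - 1); first by rewrite -opprB oppr_eq0.
by rewrite act_sigma2 /=; congr pair; field; rewrite ?q1.
Qed.

(* The coordinate of x in chart s at q = 1. *)
Definition chart_coord (s : bool) (x : R) : R := if s then x else - x^-1.

Lemma q_rational_word (x : rat) : x <> 0 -> let s := 0 < x in
  exists w, [/\ chart_coord s (ratr x) = wact 1 1 w,
    proportional (qsharp q x) (chart s (wact q 1 w)) &
    proportional (qflat q x) (chart s (wact q q w))].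
Proof.
move=> x0 s; have [l hl [lE lx]] := cf_exp_signed _ x0.
exists (cfword s l); rewrite /qsharp /qflat lE -/s; split.
- have -> : ratr x = (if s then ratr `|x| else - ratr `|x|) :> R.
    rewrite /s; case: ltP => h; first by rewrite gtr0_norm.
    by rewrite ler0_norm // rmorphN opprK.
  rewrite -lx wact_cfword // /chart_coord; case: s {lE lx} => //.
  by rewrite (cfword_negb true) wact_negb invrN opprK.
- by apply: act_beta => //; exact: act_gen_infty.
by apply: act_beta => //; [exact: ltW|exact: act_gen_flat].
Qed.

Lemma cf_exp0 : cf_exp 0 = [:: -1; 1].
Proof.
have : is_expansion (cf_exp 0) 0.
  apply: (ClassicalEpsilon.epsilon_spec _ (fun a => is_expansion a 0)).
  by exists [:: -1; 1]; left.
by case=> [[]//|[]].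
Qed.

Lemma act_beta0 P : act (beta q (cf_exp 0)) P = act (sigma1 q) (act (sigma2 q) P).
Proof. by rewrite cf_exp0 /= mulmx1 act_mul !expr1. Qed.

Lemma qsharp0 : proportional (qsharp q 0) (chart true 0).
Proof.
rewrite /qsharp act_beta0 act_sigma2 act_sigma1 /=.
by exists 1; rewrite ?oner_eq0 //=; congr pair; field.
Qed.

(** As [x] tends to 0 from the left, [-1/x] tends to oo, so the coordinate here is the limit value
    in [at_infinity]. *)
Lemma qflat0 : proportional (qflat q 0) (chart false (1 / (1 - q))).
Proof.
have q1 : 1 - q != 0 by rewrite subr_eq0 gt_eqF.
rewrite /qflat act_beta0 act_sigma2 act_sigma1 /=.
exists (q ^- 2); first by rewrite invr_neq0 // sqrf_eq0.
by rewrite /=; congr pair; field; rewrite ?q1 ?q_neq0.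
Qed.

(** * Convergence on the projective line through a chart *)

Lemma chart_neq0 s z : (chart s z).1 ^+ 2 + (chart s z).2 ^+ 2 != 0.
Proof.
rewrite gt_eqF //; case: s => /=.
  by rewrite expr1n ltr_wpDl // sqr_ge0.
by rewrite sqrrN expr1n ltr_pwDl // sqr_ge0.
Qed.

Lemma chord_proportional P Q : proportional P Q -> chord P = chord Q.
Proof.
move=> [c c0 ->]; rewrite /chord /= !exprMn.
have -> : c ^+ 2 * Q.1 ^+ 2 - c ^+ 2 * Q.2 ^+ 2 = c ^+ 2 * (Q.1 ^+ 2 - Q.2 ^+ 2) by ring.
have -> : 2 * (c * Q.1) * (c * Q.2) = c ^+ 2 * (2 * Q.1 * Q.2) by ring.
by rewrite -mulrDr -!mulf_div divff ?sqrf_eq0 // !mul1r.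
Qed.

Lemma chord_continuous s (z : R) :
  (chord (chart s u)).1 @[u --> z] --> (chord (chart s z)).1 /\
  (chord (chart s u)).2 @[u --> z] --> (chord (chart s z)).2.
Proof.
have c1 : (chart s u).1 @[u --> z] --> (chart s z).1.
  by case: s => /=; [exact: cvg_id|exact: cvg_cst].
have c2 : (chart s u).2 @[u --> z] --> (chart s z).2.
  by case: s {c1} => /=; [exact: cvg_cst|apply: cvgM; [exact: cvg_cst|exact: cvg_id]].
have sq (f : R -> R) : f u @[u --> z] --> f z -> f u ^+ 2 @[u --> z] --> f z ^+ 2.
  by move=> h; exact: cvgM.
have cV : ((chart s u).1 ^+ 2 + (chart s u).2 ^+ 2)^-1 @[u --> z] -->
    ((chart s z).1 ^+ 2 + (chart s z).2 ^+ 2)^-1.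
  by apply: cvgV; [exact: chart_neq0|apply: cvgD; exact: sq].
have c3 : 2 * (chart s u).1 @[u --> z] --> 2 * (chart s z).1.
  by apply: cvgM => //; exact: cvg_cst.
by split; apply: cvgM cV; [apply: cvgB; exact: sq|exact: cvgM].
Qed.

(** The coordinate [u] is chosen after [e] and [m], so no sequence of coordinates has to be
    constructed. *)
Lemma pconv_chart s (P : nat -> R * R) (L : R * R) (z : R) :
  proportional L (chart s z) ->
  (forall e, 0 < e -> \forall m \near \oo,
     exists2 u, `|u - z| < e & proportional (P m) (chart s u)) ->
  pconv P L.
Proof.
move=> hL hP; split.
  move=> L0; have := chart_neq0 s z; have [c c0] := proportional_sym _ _ hL.
  by rewrite L0 /= !mulr0 => -> /=; rewrite expr0n addr0 eqxx.
rewrite (chord_proportional _ _ hL).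
have [c1 c2] := chord_continuous s z.
have transfer (p : R * R -> R) : p (chord (chart s u)) @[u --> z] --> p (chord (chart s z)) ->
    (fun m => p (chord (P m))) @ \oo --> p (chord (chart s z)).
  move=> /cvgrPdist_lt hp; apply/cvgrPdist_lt => e e0.
  have [d /= d0 hd] := hp _ e0; have := hP _ d0; apply: filterS => m [u uz uP].
  by rewrite (chord_proportional _ _ uP); apply: hd; rewrite /= distrC.
by split; apply: transfer.
Qed.

(** A nonzero limit fixes the sign of the tail, so one chart serves all late terms. *)
Lemma chart_coord_near (x : nat -> rat) (t : R) (s : bool) :
  (fun m => ratr (x m) : R) @ \oo --> t -> t != 0 -> s = (0 < t) ->
  (forall d, 0 < d -> \forall m \near \oo,
    [/\ x m <> 0, (0 < x m) = s & `|chart_coord s (ratr (x m)) - chart_coord s t| < d]).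
Proof.
move=> xt t0 sE d d0.
have near_sign : \forall m \near \oo, x m <> 0 /\ (0 < x m) = s.
  have /cvgrPdist_lt /(_ `|t|) := xt; rewrite normr_gt0 => /(_ t0).
  apply: filterS => m; rewrite -(@ltr0q R) sE => hm.
  split; first by move=> x0; move: hm; rewrite x0 rmorph0 subr0 ltxx.
  move: hm t0; rewrite neq_lt; have [h|h] := ltP 0 t.
    by rewrite (gtr0_norm h) ltr_norml => /andP[h1 h2] _; lra.
  by rewrite (ler0_norm h) ltr_norml => /andP[h1 h2] _; apply/negbTE; rewrite -leNgt; lra.
have : (fun m => chart_coord s (ratr (x m)) : R) @ \oo --> chart_coord s t.
  by rewrite /chart_coord; case: s {sE near_sign} => //; apply: cvgN; exact: cvgV.
move=> /cvgrPdist_lt /(_ d d0); move: near_sign; apply: filterS2 => m [h1 h2] h3.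
by split=> //; rewrite distrC.
Qed.

(** Both charts preserve order, so left and right limits keep their sides. *)
Lemma chart_coord_lt s (x y : R) : x != 0 -> y != 0 -> (0 < x) = s -> (0 < y) = s ->
  x < y -> chart_coord s x < chart_coord s y.
Proof.
move=> x0 y0; case: s => //= hx hy xy.
have {}hx : x < 0 by rewrite lt_neqAle x0 leNgt hx.
have {}hy : y < 0 by rewrite lt_neqAle y0 leNgt hy.
by rewrite ltrN2 ltf_nV2.
Qed.
End Matrices.

(** * The three limits *)

Section Convergence.
Variables (R : realType) (q : R).
Hypotheses (q_gt0 : 0 < q) (q_lt1 : q < 1).

Lemma ratr_wact (x : rat) w : ratr (wact 1 x w) = wact (1 : R) (ratr x) w.
Proof.
elim: w => //= b w IH; rewrite /letter !mul1r -IH.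
by case: b; rewrite ?(rmorphM, fmorphV) rmorphD rmorph1.
Qed.

Lemma wact_dense (t d : R) : 0 < t -> 0 < d -> exists w, `|wact 1 0 w - t| < d.
Proof.
move=> t0 d0; have [|r] := @rat_in_itvoo R t (t + d); first by rewrite ltrDl.
rewrite in_itv /= => /andP[tr rt].
have r0 : 0 < r by rewrite -(ltr0q R); exact: lt_trans tr.
have [|w [wE _ _]] := q_rational_word _ _ q_gt0 q_lt1 r; first by move=> r0'; move: r0; rewrite r0'.
by exists (rcons w true); rewrite wact_rcons -wE r0 /= ltr_norml; lra.
Qed.

(** The set [D] stands for a two-sided or one-sided neighbourhood, or for a neighbourhood of oo. *)
Lemma qsharp_conv s (x : nat -> rat) (L : R * R) (z : R) :
  proportional _ L (chart _ q s z) ->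
  (forall e, 0 < e -> exists2 D : set R,
     (\forall m \near \oo, [/\ x m <> 0, (0 < x m) = s &
        D (chart_coord _ s (ratr (x m)))]) &
     forall w, D (wact 1 0 w) -> `|wact q 0 w - z| < e) ->
  pconv (fun m => qsharp q (x m)) L.
Proof.
move=> hL H; apply: (pconv_chart _ _ _ _ _ _ hL) => e /H[D hD hw].
move: hD; apply: filterS => m [x0 xs xD].
have [w [wE wP _]] := q_rational_word _ _ q_gt0 q_lt1 _ x0.
exists (wact q 1 w); last by rewrite -xs.
by rewrite -wact_rcons; apply: hw; rewrite wact_rcons -wE xs.
Qed.

Lemma qsharp_irrational (t : R) : (forall r : rat, ratr r <> t) ->
  exists L : R * R, forall x : nat -> rat,
    (fun m => ratr (x m) : R) @ \oo --> t -> pconv (fun m => qsharp q (x m)) L.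
Proof.
move=> tirr; have t0 : t != 0 by apply/eqP => t0; apply: (tirr 0); rewrite rmorph0.
set s := 0 < t; set T := chart_coord R s t.
have T0 : 0 < T.
  rewrite /T /chart_coord /s; case: (ltP 0 t) => h //.
  by rewrite oppr_gt0 invr_lt0 lt_neqAle t0.
have TX v : wact 1 0 v <> T.
  rewrite -[0](rmorph0 (@ratr R)) -ratr_wact /T /chart_coord; case: (s) => [|h]; first exact: tirr.
  apply: (tirr (- (wact 1 0 v)^-1)).
  by rewrite rmorphN fmorphV /= h invrN invrK opprK.
have [z hz] := limit_irrational _ _ q_gt0 q_lt1 _ (ltW T0) TX (fun d => wact_dense _ _ T0).
exists (chart _ q s z) => x xt.
apply: (@qsharp_conv s _ _ z); first by exists 1; rewrite ?oner_eq0 // !mul1r; case: chart.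
move=> e /hz[d d0 hd]; exists (fun y => `|y - T| < d) => //.
by have := chart_coord_near _ _ _ _ xt t0 erefl _ d0.
Qed.

Lemma qsharp_right (x : nat -> rat) (y : rat) :
  (fun m => ratr (x m) : R) @ \oo --> (ratr y : R) -> (forall m, y < x m) ->
  pconv (fun m => qsharp q (x m)) (qsharp q y).
Proof.
move=> xy yx; have [y0|y0] := eqVneq y 0.
  (* All terms are positive here, and 0 is the value of the empty word. *)
  apply: (@qsharp_conv true _ _ 0); first by rewrite y0; exact: qsharp0.
  move=> e /(limit_right _ _ q_gt0 q_lt1 [::])[d d0 hd].
  exists (fun u => `|u| < d /\ 0 <= u).
    move/cvgrPdist_lt/(_ _ d0): xy; apply: filterS => m; rewrite y0 rmorph0 sub0r normrN => h.
    have h0 : 0 < x m by rewrite -y0.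
    by split; [apply/eqP; rewrite gt_eqF|by []|split; rewrite //= ler0q ltW].
  by move=> w [h h0]; apply: hd; rewrite ?subr0.
have [w [wE wP _]] := q_rational_word _ _ q_gt0 q_lt1 _ (elimN eqP y0).
apply: (qsharp_conv _ _ _ _ wP) => e /(limit_right _ _ q_gt0 q_lt1 (rcons w true)).
rewrite !wact_rcons -wE => -[d d0 hd].
exists (fun u => `|u - chart_coord _ (0 < y) (ratr y)| < d /\
                 chart_coord _ (0 < y) (ratr y) <= u); last by move=> v [h1 h2]; exact: hd.
have ry0 : ratr y != 0 :> R by rewrite fmorph_eq0.
have := chart_coord_near _ _ _ (0 < y) xy ry0 (esym (ltr0q _ _)) _ d0.
apply: filterS => m [x0 xs xd]; split=> //; split=> //.
by apply/ltW/chart_coord_lt; rewrite ?fmorph_eq0 ?ltr0q ?ltr_rat //; exact/eqP.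
Qed.

Lemma qsharp_left (x : nat -> rat) (y : rat) :
  (fun m => ratr (x m) : R) @ \oo --> (ratr y : R) -> (forall m, x m < y) ->
  pconv (fun m => qsharp q (x m)) (qflat q y).
Proof.
move=> xy yx; have [y0|y0] := eqVneq y 0.
  apply: (@qsharp_conv false _ _ (1 / (1 - q))); first by rewrite y0; exact: qflat0.
  move=> e /(geometric_small _ _ q_gt0 q_lt1)[n hn].
  exists (fun u => n%:R <= u); last first.
    by move=> w /(at_infinity _ _ q_gt0 q_lt1)/le_lt_trans; apply.
  (* The bound [|x m| < 1 / (n + 1)] gives [-1 / x m > n]; the successor keeps the radius positive
     when [n = 0]. *)
  have n0 : 0 < n.+1%:R^-1 :> R by rewrite invr_gt0.
  move/cvgrPdist_lt/(_ _ n0): xy; apply: filterS => m; rewrite y0 rmorph0 sub0r normrN => h.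
  have h0 : x m < 0 by rewrite -y0.
  have r0 : ratr (x m) < 0 :> R by rewrite ltrq0.
  split; [by apply/eqP; rewrite lt_eqF|by rewrite lt_gtF|rewrite /= -invrN].
  move: h; rewrite ltr0_norm // => h.
  have nn : (n%:R : R) <= n.+1%:R by rewrite ler_nat.
  apply: (le_trans nn); rewrite -[n.+1%:R]invrK lef_pV2 ?posrE ?oppr_gt0 //.
  exact: ltW.
have [w [wE _ wP]] := q_rational_word _ _ q_gt0 q_lt1 _ (elimN eqP y0).
apply: (qsharp_conv _ _ _ _ wP) => e /(limit_left _ _ q_gt0 q_lt1 w).
rewrite -wE => -[d d0 hd].
exists (fun u => `|u - chart_coord _ (0 < y) (ratr y)| < d /\
                 u < chart_coord _ (0 < y) (ratr y)); last by move=> v [h1 h2]; exact: hd.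
have ry0 : ratr y != 0 :> R by rewrite fmorph_eq0.
have := chart_coord_near _ _ _ (0 < y) xy ry0 (esym (ltr0q _ _)) _ d0.
apply: filterS => m [x0 xs xd]; split=> //; split=> //.
by apply: chart_coord_lt; rewrite ?fmorph_eq0 ?ltr0q ?ltr_rat //; exact/eqP.
Qed.

End Convergence.

Theorem theorem2p11 (R : realType) (q : R) (hq0 : 0 < q) (hq1 : q < 1) :
  (* (1) limit at an irrational t exists and depends only on t *)
  (forall t : R, (forall r : rat, ratr r <> t) ->
     exists L : R * R, forall x : nat -> rat,
       (fun m => ratr (x m) : R) @ \oo --> t ->
       pconv (fun m => qsharp q (x m)) L)
  /\
  (* (2) convergence to a rational from the right *)
  (forall (x : nat -> rat) (y : rat),
     (fun m => ratr (x m) : R) @ \oo --> (ratr y : R) ->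
     (forall m, y < x m) ->
     pconv (fun m => qsharp q (x m)) (qsharp q y))
  /\
  (* (3) convergence to a rational from the left *)
  (forall (x : nat -> rat) (y : rat),
     (fun m => ratr (x m) : R) @ \oo --> (ratr y : R) ->
     (forall m, x m < y) ->
     pconv (fun m => qsharp q (x m)) (qflat q y)).
Proof.
split; first by move=> t; exact: qsharp_irrational.
by split=> x y; [exact: qsharp_right|exact: qsharp_left].
Qed.
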